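(* Let $\mathcal H$ be an infinite-dimensional separable Hilbert space. There exist a frame $\{f_i\}_{i=1}^\infty$ for $\mathcal H$ with lower frame bound $A>0$ which contains a Riesz basis and has infinite excess, a frame $\{g_i\}_{i=1}^\infty$ for $\mathcal H$ which does not contain a Riesz basis, and numbers $\lambda,\mu\ge 0$ with $\lambda+\frac{\mu}{\sqrt A}<1$ such that $$\Big\|\sum c_i(f_i-g_i)\Big\|\le\lambda\Big\|\sum c_if_i\Big\|+\mu\sqrt{\sum|c_i|^2}$$ for all finite scalar sequences $\{c_i\}$.
   Context: A countable family $\{f_i\}_{i\in I}$ in $\mathcal H$ is a frame for $\mathcal H$ if there are $A,B>0$ (a lower and an upper frame bound) with $A\|f\|^2\le\sum_{i\in I}|\langle f,f_i\rangle|^2\le B\|f\|^2$ for all $f\in\mathcal H$. A Riesz basis for $\mathcal H$ is a family which is the image of an orthonormal basis of $\mathcal H$ under a bounded invertible operator on $\mathcal H$. A frame contains a Riesz basis if some subfamily of it is a Riesz basis for $\mathcal H$; it has infinite excess if it consists of a Riesz basis for $\mathcal H$ plus infinitely many elements. *)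

(* Defs.v *)
From HB Require Import structures.
From mathcomp Require Import all_boot all_order all_algebra.
From mathcomp Require Import sesquilinear complex.
From mathcomp Require Import all_classical all_reals.
From mathcomp Require Import ereal topology normedtype sequences.
Set Implicit Arguments.
Unset Strict Implicit.
Unset Printing Implicit Defensive.
Import Order.TTheory GRing.Theory Num.Theory.
Import numFieldNormedType.Exports.
Local Open Scope classical_set_scope.
Local Open Scope ring_scope.

(* Hilbert spaces over the real and over the complex numbers are treated
   uniformly: [scalar_field R k] is R or R[i]. *)
Variant scalar_kind := RealScalars | ComplexScalars.

Definition scalar_field (R : realType) (k : scalar_kind) : numFieldType :=
  match k with RealScalars => R | ComplexScalars => R[i] end.

Definition conj_scalar (R : realType) (k : scalar_kind) :
    scalar_field R k -> scalar_field R k :=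
  match k with RealScalars => idfun | ComplexScalars => @conjc R end.

(* Norms and absolute values lie in [scalar_field R k]; they are nonnegative,
   hence real, and [re_scalar] reads them as elements of R. *)
Definition re_scalar (R : realType) (k : scalar_kind) : scalar_field R k -> R :=
  match k with RealScalars => idfun | ComplexScalars => @complex.Re R end.

Definition abs_scalar (R : realType) (k : scalar_kind)
    (c : scalar_field R k) : R :=
  re_scalar `|c|.

Definition vnorm (R : realType) (k : scalar_kind)
    (H : normedModType (scalar_field R k)) (x : H) : R :=
  re_scalar `|x|.

Definition separable (T : topologicalType) : Prop :=
  exists D : set T, countable D /\ dense D.

Definition infinite_dimensional (K : numFieldType) (V : lmodType K) : Prop :=
  forall (n : nat) (v : 'I_n -> V),
    exists x : V, forall c : 'I_n -> K, x <> \sum_(i < n) c i *: v i.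

Section HilbertSpace.
Variables (R : realType) (k : scalar_kind).
Variable H : completeNormedModType (scalar_field R k).
Variable dot : {dot H for @conj_scalar R k}.
Implicit Types (f e : nat -> H) (J : set nat) (A B : R).

(* A complete normed space with this property is a Hilbert space for [dot],
   which is linear in its first argument. *)
Definition norm_induced_by : Prop := forall x : H, `|x| ^+ 2 = dot x x.

Definition upper_frame_bound f B : Prop :=
  0 < B /\ forall x : H,
    (\sum_(0 <= i <oo) ((abs_scalar (dot x (f i)) ^+ 2)%:E)
       <= (B * vnorm x ^+ 2)%:E)%E.

Definition lower_frame_bound f A : Prop :=
  0 < A /\ forall x : H,
    ((A * vnorm x ^+ 2)%:E
       <= \sum_(0 <= i <oo) ((abs_scalar (dot x (f i)) ^+ 2)%:E))%E.

Definition frame f : Prop :=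
  (exists A, lower_frame_bound f A) /\ (exists B, upper_frame_bound f B).

Definition bounded_operator (T : H -> H) : Prop :=
  exists M : R, forall x, vnorm (T x) <= M * vnorm x.

Definition bounded_invertible (T : {linear H -> H}) : Prop :=
  bounded_operator T /\
  exists S : {linear H -> H}, [/\ bounded_operator S, cancel T S & cancel S T].

(* In the next three definitions the families are (e j)_{j in J} and
   (f j)_{j in J}; values at indices outside J are irrelevant. *)
Definition family_span J e : set H :=
  [set x | exists (n : nat) (c : nat -> scalar_field R k),
     x = \sum_(j < n | (j : nat) \in J) c j *: e j].

Definition orthonormal_basis J e : Prop :=
  (forall i j, J i -> J j -> dot (e i) (e j) = (i == j)%:R) /\
  dense (family_span J e).

Definition riesz_basis J f : Prop :=
  exists (e : nat -> H) (T : {linear H -> H}),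
    [/\ orthonormal_basis J e, bounded_invertible T
      & forall j, J j -> f j = T (e j)].

Definition contains_riesz_basis f : Prop := exists J, riesz_basis J f.

Definition infinite_excess f : Prop :=
  exists J, riesz_basis J f /\ infinite_set (~` J).

End HilbertSpace.

(* Main.v *)
Require Import Defs.
From HB Require Import structures.
From mathcomp Require Import all_boot all_order all_algebra.
From mathcomp Require Import sesquilinear complex.
From mathcomp Require Import all_classical all_reals.
From mathcomp Require Import ereal topology normedtype sequences.
Set Implicit Arguments.
Unset Strict Implicit.
Unset Printing Implicit Defensive.
Import Order.TTheory GRing.Theory Num.Theory.
Import numFieldNormedType.Exports.
Local Open Scope classical_set_scope.
Local Open Scope ring_scope.

(** Let [e] be an orthonormal basis of the space, cut out of it disjoint blocks
    [e (4 ^ m), ..., e (2 * 4 ^ m - 1)], let [u m] be the unit vector along the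
    sum of block [m], and let [P] be the orthogonal projection onto the closed
    span of the [u m].  The two families are

      f : the vectors [(1 - P / 2) (e j)] together with the [u m],
      g : the vectors [(1 - P) (e j)] together with the [u m].

    By Parseval's identity the frame sums of [x] are [|x|^2 + |P x|^2 / 4] for
    [f] and [|x|^2] for [g], so both are frames and [1] is a lower bound for
    [f].  As [1 - P / 2] has the bounded inverse [1 + P], the vectors
    [(1 - P / 2) (e j)] form a Riesz basis contained in [f], and infinitely many
    vectors [u m] remain.  The difference [f - g] consists of the vectors
    [P (e j) / 2] and of zeros, hence the perturbation inequality holds with
    [lambda = 0] and [mu = 1 / 2].

    That [g] contains no Riesz basis is [not_contains_riesz_basis]: completeness
    of a subfamily allows it to omit at most one vector per block, since
    [e i - e j] with [i] and [j] in one block is orthogonal to every other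
    element of [g].  But the [4 ^ m] vectors [(1 - P) (e j)] of block [m] sum to
    zero, so [4 ^ m - 1] of them have a sum of norm at most one, which no lower
    Riesz bound permits for all [m].

    Real and complex scalars are treated together: norms and moduli are read
    in the reals through [re_scalar], which is additive and monotone, and
    multiplicative as soon as one factor is nonnegative. *)

(** * Scalars *)

Section Scalars.
Variables (R : realType) (k : scalar_kind).
Local Notation K := (scalar_field R k).
Implicit Types (a b : K).

Lemma conj_scalarD a b :
  conj_scalar (a + b) = conj_scalar a + conj_scalar b.
Proof. by move: a b; case: k => //= a b; rewrite rmorphD. Qed.

Lemma conj_scalar0 : conj_scalar (0 : K) = 0.
Proof. by apply: (addrI (conj_scalar 0)); rewrite -conj_scalarD !addr0. Qed.

Lemma conj_scalarK : involutive (@conj_scalar R k).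
Proof. by case: k => //= a; rewrite conjcK. Qed.

Lemma sqr_norm_scalar a : `|a| ^+ 2 = a * conj_scalar a.
Proof.
move: a; case: k => /= a; last exact: sqr_normc.
by rewrite real_normK ?num_real // expr2.
Qed.

Lemma re_scalarD a b : re_scalar (a + b) = re_scalar a + re_scalar b.
Proof. by move: a b; case: k => //= -[? ?] [? ?]. Qed.

Lemma re_scalar0 : re_scalar (0 : K) = 0.
Proof. by case: k. Qed.

Lemma re_scalarB a b : re_scalar (a - b) = re_scalar a - re_scalar b.
Proof. by move: a b; case: k => //= -[? ?] [? ?]. Qed.

Lemma re_scalar_sum I (r : seq I) (P : pred I) (F : I -> K) :
  re_scalar (\sum_(i <- r | P i) F i) = \sum_(i <- r | P i) re_scalar (F i).
Proof. exact: (big_morph _ re_scalarD re_scalar0). Qed.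

Lemma re_scalar_nat n : re_scalar (n%:R : K) = n%:R.
Proof.
elim: n => [|n IHn]; first by case: k.
by rewrite -addn1 natrD re_scalarD IHn natrD; case: k.
Qed.

Lemma re_scalar_le a b : a <= b -> re_scalar a <= re_scalar b.
Proof. by move: a b; case: k => //= a b; rewrite lecE => /andP[]. Qed.

Lemma re_scalar_lt a b : a < b -> re_scalar a < re_scalar b.
Proof. by move: a b; case: k => //= a b; rewrite ltcE => /andP[]. Qed.

Lemma lt_of_re_scalar a b : 0 <= a -> 0 <= b ->
  re_scalar a < re_scalar b -> a < b.
Proof.
move: a b; case: k => //= a b; rewrite !lecE ltcE => /andP[/eqP-> _].
by move=> /andP[/eqP-> _] ->; rewrite eqxx.
Qed.

Lemma pos_scalar (r : R) : 0 < r -> exists2 a : K, 0 < a & re_scalar a = r.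
Proof.
case: k => /= r0; first by exists r.
by exists r%:C%C; rewrite // ltcE /= eqxx.
Qed.

Lemma re_scalarM a b : 0 <= a -> re_scalar (a * b) = re_scalar a * re_scalar b.
Proof.
move: a b; case: k => //= -[a1 a2] [b1 b2]; rewrite lecE /= => /andP[/eqP-> _].
by rewrite mul0r subr0.
Qed.

Lemma re_scalar_ge0 a : 0 <= a -> 0 <= re_scalar a.
Proof. by move=> /re_scalar_le; rewrite re_scalar0. Qed.

Lemma abs_scalar_ge0 a : 0 <= abs_scalar a.
Proof. exact: re_scalar_ge0. Qed.

Lemma abs_scalar0 : abs_scalar (0 : K) = 0.
Proof. by rewrite /abs_scalar normr0 re_scalar0. Qed.

Lemma abs_scalarD a b : abs_scalar (a + b) <= abs_scalar a + abs_scalar b.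
Proof. by rewrite /abs_scalar -re_scalarD; apply/re_scalar_le/ler_normD. Qed.

Lemma abs_scalarM a b : abs_scalar (a * b) = abs_scalar a * abs_scalar b.
Proof. by rewrite /abs_scalar normrM re_scalarM. Qed.

Lemma abs_scalar_nat n : abs_scalar (n%:R : K) = n%:R.
Proof. by rewrite /abs_scalar normr_nat re_scalar_nat. Qed.

Lemma abs_scalar_eq0 a : abs_scalar a = 0 -> a = 0.
Proof.
have [-> //|] := eqVneq a 0; rewrite -normr_gt0 => /re_scalar_lt.
by rewrite re_scalar0 -/(abs_scalar a) => /[swap] ->; rewrite ltxx.
Qed.

Lemma abs_scalar_sqr a : abs_scalar a ^+ 2 = re_scalar (a * conj_scalar a).
Proof. by rewrite -sqr_norm_scalar /abs_scalar !expr2 re_scalarM. Qed.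

Lemma abs_conj_scalar a : abs_scalar (conj_scalar a) = abs_scalar a.
Proof.
apply/eqP; rewrite -(eqrXn2 (n := 2)) ?abs_scalar_ge0 //.
by rewrite !abs_scalar_sqr conj_scalarK mulrC.
Qed.

Lemma abs_scalarN a : abs_scalar (- a) = abs_scalar a.
Proof. by rewrite /abs_scalar normrN. Qed.

Lemma re_scalar_abs a : re_scalar a <= abs_scalar a.
Proof.
move: a; rewrite /abs_scalar; case: k => /= a; first exact: ler_norm.
have := normc_ge_Re a; rewrite lecR; apply: le_trans; exact: ler_norm.
Qed.

End Scalars.

(** * Inner products *)

Section InnerProduct.
Variables (R : realType) (k : scalar_kind).
Local Notation K := (scalar_field R k).
Variable H : completeNormedModType K.
Variable dot : {dot H for @conj_scalar R k}.
Hypothesis hnorm : norm_induced_by dot.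
Implicit Types (x y z : H) (a : K).

Lemma dotC x y : dot x y = conj_scalar (dot y x).
Proof. by rewrite hermitian_subproof expr0 mul1r. Qed.

Lemma dot0l y : dot 0 y = 0. Proof. exact: linear0l. Qed.
Lemma dotDl x y z : dot (x + y) z = dot x z + dot y z.
Proof. exact: linearDl. Qed.
Lemma dotBl x y z : dot (x - y) z = dot x z - dot y z.
Proof. exact: linearBl. Qed.
Lemma dotZl a x y : dot (a *: x) y = a * dot x y.
Proof. exact: linearZl_LR. Qed.
Lemma dot_suml I (r : seq I) (P : pred I) (F : I -> H) y :
  dot (\sum_(i <- r | P i) F i) y = \sum_(i <- r | P i) dot (F i) y.
Proof. exact: linear_sumlz. Qed.

Lemma dot0r y : dot y 0 = 0. Proof. exact: linear0r. Qed.
Lemma dotDr x y z : dot x (y + z) = dot x y + dot x z.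
Proof. exact: linearDr. Qed.
Lemma dotBr x y z : dot x (y - z) = dot x y - dot x z.
Proof. exact: linearBr. Qed.
Lemma dotZr a x y : dot x (a *: y) = conj_scalar a * dot x y.
Proof. exact: linearZr_LR. Qed.
Lemma dot_sumr I (r : seq I) (P : pred I) (F : I -> H) y :
  dot y (\sum_(i <- r | P i) F i) = \sum_(i <- r | P i) dot y (F i).
Proof. exact: linear_sumr. Qed.

Lemma dot_eq0C x y : dot x y = 0 -> dot y x = 0.
Proof. by move=> xy; rewrite dotC xy conj_scalar0. Qed.

Lemma vnorm_ge0 x : 0 <= vnorm x.
Proof. exact: re_scalar_ge0. Qed.

Lemma vnorm0 : vnorm (0 : H) = 0.
Proof. by rewrite /vnorm normr0 re_scalar0. Qed.

Lemma vnorm_eq0 x : vnorm x = 0 -> x = 0.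
Proof.
have [-> //|] := eqVneq x 0; rewrite -normr_gt0 => /re_scalar_lt.
by rewrite re_scalar0 -/(vnorm x) => /[swap] ->; rewrite ltxx.
Qed.

Lemma vnormD x y : vnorm (x + y) <= vnorm x + vnorm y.
Proof. by rewrite /vnorm -re_scalarD; apply/re_scalar_le/ler_normD. Qed.

Lemma vnormN x : vnorm (- x) = vnorm x.
Proof. by rewrite /vnorm normrN. Qed.

Lemma vnormZ a x : vnorm (a *: x) = abs_scalar a * vnorm x.
Proof. by rewrite /vnorm normrZ re_scalarM. Qed.

Lemma vnorm_sqr x : vnorm x ^+ 2 = re_scalar (dot x x).
Proof. by rewrite -hnorm /vnorm !expr2 re_scalarM. Qed.

Lemma pythagoras x y :
  dot x y = 0 -> vnorm (x + y) ^+ 2 = vnorm x ^+ 2 + vnorm y ^+ 2.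
Proof.
move=> xy; rewrite !vnorm_sqr dotDl !dotDr xy (dot_eq0C xy).
by rewrite addr0 add0r re_scalarD.
Qed.

(** The component of [x] along [y] has norm [|dot x y| / |y|], and by
    orthogonality of the remainder it is no longer than [x]. *)
Lemma cauchy_schwarz x y : abs_scalar (dot x y) <= vnorm x * vnorm y.
Proof.
have [->|y0] := eqVneq y 0; first by rewrite dot0r abs_scalar0 vnorm0 mulr0.
have dy0 : dot y y != 0 by rewrite -hnorm expf_neq0 // normr_eq0.
pose a := dot x y / dot y y.
have orth : dot (x - a *: y) (a *: y) = 0.
  by rewrite dotZr dotBl dotZl mulfVK // subrr mulr0.
have := pythagoras orth; rewrite subrK => Px.
have le_ax : vnorm (a *: y) <= vnorm x.
  by rewrite -(ler_pXn2r (n := 2)) ?nnegrE ?vnorm_ge0 // Px lerDr sqr_ge0.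
have xy : dot x y = a * dot y y by rewrite mulfVK.
clearbody a; rewrite {}xy.
rewrite -hnorm expr2 !abs_scalarM.
have -> : abs_scalar `|y| = vnorm y by rewrite /abs_scalar normr_id.
by rewrite mulrA -vnormZ ler_wpM2r ?vnorm_ge0.
Qed.

Lemma sqr_vnorm_orthonormal_sum (I : finType) (P : pred I) (w : I -> H)
    (c : I -> K) :
  (forall i j, P i -> P j -> dot (w i) (w j) = (i == j)%:R) ->
  vnorm (\sum_(i | P i) c i *: w i) ^+ 2
    = \sum_(i | P i) abs_scalar (c i) ^+ 2.
Proof.
move=> ow; rewrite vnorm_sqr dot_suml re_scalar_sum; apply: eq_bigr => i Pi.
rewrite dotZl dot_sumr (bigD1 i) //= big1 => [|j /andP[Pj ji]].
  by rewrite dotZr ow // eqxx mulr1 addr0 abs_scalar_sqr.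
by rewrite dotZr ow // eq_sym (negbTE ji) mulr0.
Qed.

(** * Orthogonal projections *)

(** Norm convergence, phrased in the reals so that limits of numerical
    sequences apply whatever the scalars are. *)
Definition vcvg (s : nat -> H) (y : H) : Prop :=
  vnorm (y - s n) @[n --> \oo] --> (0 : R).

Lemma squeeze0 (a b : nat -> R) : (forall n, 0 <= a n <= b n) ->
  b n @[n --> \oo] --> (0 : R) -> a n @[n --> \oo] --> (0 : R).
Proof.
by move=> ab; apply: squeeze_cvgr; [near=> n; exact: ab | exact: cvg_cst].
Unshelve. all: by end_near. Qed.

Lemma vcvg_unique s y z : vcvg s y -> vcvg s z -> y = z.
Proof.
move=> sy sz; apply/eqP; rewrite -subr_eq0; apply/eqP/vnorm_eq0.
have h0 : (fun _ : nat => vnorm (y - z)) n @[n --> \oo] --> (0 : R).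
  apply: (@squeeze0 _ (fun n => vnorm (y - s n) + vnorm (z - s n))).
    move=> n; rewrite vnorm_ge0 -[vnorm (z - s n)]vnormN opprB.
    by apply: le_trans (vnormD _ _); rewrite addrA subrK.
  by rewrite -[0]addr0; apply: cvgD.
by apply: cvg_unique h0; [exact: Rhausdorff | exact: cvg_cst].
Qed.

Lemma vcvg_linear a s t y z : vcvg s y -> vcvg t z ->
  vcvg (fun n => a *: s n + t n) (a *: y + z).
Proof.
move=> sy tz.
apply: (@squeeze0 _
  (fun n => abs_scalar a * vnorm (y - s n) + vnorm (z - t n))).
  move=> n; rewrite vnorm_ge0 opprD addrACA -scalerBr -vnormZ; exact: vnormD.
by rewrite -[0]addr0 -[X in X + _](mulr0 (abs_scalar a)); apply: cvgD => //;
  apply: cvgMr.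
Qed.

Lemma vcvg_dot s y z : vcvg s y ->
  abs_scalar (dot y z - dot (s n) z) @[n --> \oo] --> (0 : R).
Proof.
move=> sy; apply: (@squeeze0 _ (fun n => vnorm (y - s n) * vnorm z)).
  by move=> n; rewrite abs_scalar_ge0 -dotBl cauchy_schwarz.
by rewrite -[X in _ --> X](mul0r (vnorm z)); apply: cvgMl.
Qed.

Definition orthonormal_seq (u : nat -> H) : Prop :=
  forall i j, dot (u i) (u j) = (i == j)%:R.

Definition fourier_sum (u : nat -> H) (x : H) (n : nat) : H :=
  \sum_(i < n) dot x (u i) *: u i.

Lemma fourier_sum_linear u a x y n :
  fourier_sum u (a *: x + y) n = a *: fourier_sum u x n + fourier_sum u y n.
Proof.
rewrite /fourier_sum scaler_sumr -big_split; apply: eq_bigr => i _ /=.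
by rewrite dotDl dotZl scalerDl scalerA.
Qed.

Lemma fourier_sum_selfadjoint u x y n :
  dot (fourier_sum u x n) y = dot x (fourier_sum u y n).
Proof.
rewrite /fourier_sum dot_suml dot_sumr; apply: eq_bigr => i _.
by rewrite dotZl dotZr -dotC mulrC.
Qed.

Section Fourier.
Variable u : nat -> H.
Hypothesis ou : orthonormal_seq u.

Lemma sqr_vnorm_fourier_sumB x m n : (m <= n)%N ->
  vnorm (fourier_sum u x n - fourier_sum u x m) ^+ 2
  = \sum_(i < n) abs_scalar (dot x (u i)) ^+ 2
    - \sum_(i < m) abs_scalar (dot x (u i)) ^+ 2.
Proof.
move=> mn; rewrite /fourier_sum.
rewrite -!(big_mkord xpredT (fun i => dot x (u i) *: u i)).
rewrite -!(big_mkord xpredT (fun i => abs_scalar (dot x (u i)) ^+ 2)).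
rewrite (big_cat_nat (n := m)) //= [X in _ = X - _](big_cat_nat (n := m)) //=.
rewrite [X in vnorm (X - _)]addrC [X in _ = X - _]addrC !addrK.
rewrite -[m]add0n !big_addn !big_mkord.
by apply: sqr_vnorm_orthonormal_sum => i j _ _; rewrite ou eqn_add2r.
Qed.

Lemma dot_fourier_sum x n j :
  dot (fourier_sum u x n) (u j) = dot x (u j) *+ (j < n).
Proof.
rewrite /fourier_sum dot_suml; case: (ltnP j n) => [jn|nj].
  rewrite (bigD1 (Ordinal jn)) //= big1 => [|i /negP ij].
    by rewrite dotZl ou eqxx mulr1 addr0.
  by rewrite dotZl ou; case: eqP => [e|]; rewrite ?mulr0 //;
    case: ij; apply/eqP/val_inj.
by rewrite big1 // => i _; rewrite dotZl ou ltn_eqF ?mulr0 // (leq_trans _ nj).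
Qed.

Lemma bessel x n :
  \sum_(i < n) abs_scalar (dot x (u i)) ^+ 2 <= vnorm x ^+ 2.
Proof.
have orth : dot (x - fourier_sum u x n) (fourier_sum u x n) = 0.
  rewrite {2}/fourier_sum dot_sumr big1 // => i _.
  by rewrite dotZr dotBl dot_fourier_sum ltn_ord subrr mulr0.
have := pythagoras orth; rewrite subrK => ->.
have := sqr_vnorm_fourier_sumB x (leq0n n).
rewrite {2}/fourier_sum !big_ord0 !subr0 => ->.
by rewrite lerDr sqr_ge0.
Qed.

(** By orthogonality the squared distance of two partial sums is a difference
    of partial sums of a real series that Bessel's inequality bounds, so the
    Fourier series is Cauchy. *)
Lemma fourier_sum_cvg x : exists y, vcvg (fourier_sum u x) y.
Proof.
pose a n := \sum_(i < n) abs_scalar (dot x (u i)) ^+ 2.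
have a_incr : {homo a : m n / (m <= n)%N >-> m <= n}.
  move=> m n mn; rewrite -subr_ge0 -sqr_vnorm_fourier_sumB //; exact: sqr_ge0.
have a_cvg : cvgn a.
  apply: nondecreasing_is_cvgn => //; exists (vnorm x ^+ 2) => _ [n _ <-].
  exact: bessel.
have a_le n : a n <= limn a by exact: nondecreasing_cvgn_le.
have S_cauchy : cauchy_ex (fourier_sum u x n @[n --> \oo]).
  move=> eps eps0.
  have re0 : 0 < re_scalar eps by rewrite -(re_scalar0 R k) re_scalar_lt.
  have [N _ aN] : \forall n \near \oo, `|limn a - a n| < re_scalar eps ^+ 2.
    by move/cvgrPdist_lt: a_cvg; apply; rewrite exprn_gt0.
  exists (fourier_sum u x N); exists N => // n /= Nn.
  rewrite -ball_normE /= distrC; apply: lt_of_re_scalar => //; first exact: ltW.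
  rewrite -/(vnorm _) -(ltr_pXn2r (n := 2)) ?nnegrE ?vnorm_ge0 ?(ltW re0) //.
  rewrite sqr_vnorm_fourier_sumB //; apply: le_lt_trans (aN N (leqnn N)).
  by rewrite ger0_norm ?subr_ge0 ?a_le // lerD2r; exact: a_le.
have S_cvg : cvg (fourier_sum u x n @[n --> \oo]).
  by apply: cauchy_cvg; exact: cauchy_exP.
exists (lim (fourier_sum u x n @[n --> \oo])).
apply/cvgrPdist_lt => eps /(pos_scalar k)[e e0 <-].
move/cvgrPdist_lt: S_cvg => /(_ e e0); apply: filterS => n /re_scalar_lt.
by rewrite sub0r normrN ger0_norm ?vnorm_ge0.
Qed.

(** The limit of the Fourier series with respect to [u], which is the
    orthogonal projection onto the closed span of [u].  Only this description
    by a limit is used to derive its properties. *)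
Lemma orthogonal_projection :
  exists P : {linear H -> H}, forall x, vcvg (fourier_sum u x) (P x).
Proof.
have [f fP] := choice fourier_sum_cvg.
have f_linear : linear f.
  move=> a x y; apply: (vcvg_unique (fP _)).
  rewrite (_ : fourier_sum u _ = fun n => a *: fourier_sum u x n
                                           + fourier_sum u y n).
    exact: vcvg_linear.
  by apply/funext => n; exact: fourier_sum_linear.
pose F := GRing.isLinear.Build K H H *:%R f f_linear.
by exists (HB.pack_for {linear H -> H} f F).
Qed.

Variable P : {linear H -> H}.
Hypothesis projP : forall x, vcvg (fourier_sum u x) (P x).

(** Passing to the limit in the corresponding identity for partial sums. *)
Lemma proj_selfadjoint x y : dot (P x) y = dot x (P y).
Proof.
apply/eqP; rewrite -subr_eq0; apply/eqP/abs_scalar_eq0.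
have h0 : (fun _ : nat => abs_scalar (dot (P x) y - dot x (P y))) n
    @[n --> \oo] --> (0 : R).
  apply: (@squeeze0 _ (fun n =>
    abs_scalar (dot (P x) y - dot (fourier_sum u x n) y)
    + abs_scalar (dot (P y) x - dot (fourier_sum u y n) x))).
    move=> n; rewrite abs_scalar_ge0 fourier_sum_selfadjoint.
    have -> : abs_scalar (dot (P y) x - dot (fourier_sum u y n) x)
        = abs_scalar (dot x (fourier_sum u y n) - dot x (P y)).
      rewrite -dotBl -dotBr dotC abs_conj_scalar.
      by rewrite -abs_scalarN -linearNr opprB.
    by apply: le_trans (abs_scalarD _ _); rewrite addrA subrK.
  by rewrite -[0]addr0; apply: cvgD; exact: vcvg_dot.
by apply: cvg_unique h0; [exact: Rhausdorff | exact: cvg_cst].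
Qed.

Lemma proj_eventually x y N :
  (forall n, (N <= n)%N -> fourier_sum u x n = y) -> P x = y.
Proof.
move=> xy; apply: (vcvg_unique (projP x)); rewrite /vcvg.
apply: (@cvg_near_cst); exists N => // n /= Nn.
by rewrite xy // subrr vnorm0.
Qed.

Lemma proj_id j : P (u j) = u j.
Proof.
apply: (@proj_eventually _ _ j.+1) => n jn.
rewrite /fourier_sum (bigD1 (Ordinal jn)) //= big1 => [|i ij].
  by rewrite ou eqxx scale1r addr0.
rewrite ou (_ : (j == i) = false) ?scale0r //.
by apply: contraNF ij => /eqP ji; apply/eqP/val_inj.
Qed.

Lemma dot_proj x j : dot (P x) (u j) = dot x (u j).
Proof. by rewrite proj_selfadjoint proj_id. Qed.

Lemma proj_idempotent x : P (P x) = P x.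
Proof.
apply: (vcvg_unique (projP _)).
rewrite (_ : fourier_sum u _ = fourier_sum u x) //.
by apply/funext => n; apply: eq_bigr => i _; rewrite dot_proj.
Qed.

Lemma proj_orthogonal x : dot (x - P x) (P x) = 0.
Proof. by rewrite -proj_selfadjoint linearB /= proj_idempotent subrr dot0l. Qed.

Lemma sqr_vnorm_proj x :
  vnorm x ^+ 2 = vnorm (x - P x) ^+ 2 + vnorm (P x) ^+ 2.
Proof. by rewrite -pythagoras ?proj_orthogonal // subrK. Qed.

Lemma vnorm_proj_le x : vnorm (P x) <= vnorm x.
Proof.
rewrite -(ler_pXn2r (n := 2)) ?nnegrE ?vnorm_ge0 // (sqr_vnorm_proj x).
by rewrite lerDr sqr_ge0.
Qed.

(** The partial sum of squares is [dot (fourier_sum u x n) x], which tends to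
    [dot (P x) x], that is to the square of the norm of [P x]. *)
Lemma parseval x :
  \sum_(i < n) abs_scalar (dot x (u i)) ^+ 2 @[n --> \oo]
    --> vnorm (P x) ^+ 2.
Proof.
have -> : vnorm (P x) ^+ 2 = re_scalar (dot (P x) x).
  by rewrite vnorm_sqr proj_selfadjoint proj_idempotent -proj_selfadjoint.
apply/cvgrPdist_lt => eps eps0.
have /cvgrPdist_lt/(_ eps eps0) := vcvg_dot x (projP x).
apply: filterS => n; rewrite sub0r normrN ger0_norm ?abs_scalar_ge0 //.
apply: le_lt_trans.
have -> : \sum_(i < n) abs_scalar (dot x (u i)) ^+ 2
    = re_scalar (dot (fourier_sum u x n) x).
  rewrite dot_suml re_scalar_sum; apply: eq_bigr => i _.
  by rewrite abs_scalar_sqr dotZl -dotC.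
rewrite ler_norml; apply/andP; split.
  rewrite -[X in - X]abs_scalarN opprB lerNl opprB.
  by apply: le_trans (re_scalar_abs _); rewrite re_scalarB.
by apply: le_trans (re_scalar_abs _); rewrite re_scalarB.
Qed.

Lemma proj_total x :
  (forall y, (forall i, dot y (u i) = 0) -> y = 0) -> P x = x.
Proof.
move=> total; apply/eqP; rewrite -subr_eq0; apply/eqP/total => i.
by rewrite dotBl dot_proj subrr.
Qed.

End Fourier.

(** * Dense subsets and orthonormal bases *)

(** Density in terms of the real-valued norm; unlike the topological notion, it
    passes to images by bounded surjections through a mere estimate. *)
Definition norm_dense (D : set H) : Prop :=
  forall x eps, 0 < eps -> exists2 y, D y & vnorm (x - y) < eps.

Lemma dense_norm_dense (D : set H) : dense D -> norm_dense D.
Proof.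
move=> denD x eps /(pos_scalar k)[e e0 <-].
have O0 : (ball x e)^° !=set0 by exists x; exact: nbhsx_ballx.
have [y [yx Dy]] := denD _ O0 (open_interior _).
exists y => //; apply: re_scalar_lt; move/interior_subset: yx.
by rewrite -ball_normE.
Qed.

Lemma norm_dense_orthogonal (D : set H) x :
  norm_dense D -> (forall y, D y -> dot x y = 0) -> x = 0.
Proof.
move=> denD xD; apply: vnorm_eq0; apply/eqP; apply: contraT => x0.
have {}x0 : 0 < vnorm x by rewrite lt_neqAle eq_sym x0 vnorm_ge0.
have [y Dy xy] := denD x _ x0.
suff : vnorm x ^+ 2 < vnorm x ^+ 2 by rewrite ltxx.
rewrite {1}vnorm_sqr -[dot x x]subr0 -(xD y Dy) -dotBr.
apply: (le_lt_trans (re_scalar_abs _)).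
apply: (le_lt_trans (cauchy_schwarz _ _)).
by rewrite expr2 ltr_pM2l.
Qed.

(** [T] maps a point close to [S x] to a point close to [T (S x) = x]. *)
Lemma norm_dense_image (D : set H) (T S : {linear H -> H}) :
  bounded_operator T -> cancel S T -> norm_dense D ->
  norm_dense (T @` D).
Proof.
move=> [M TM] ST denD x eps eps0.
have M0 : 0 < `|M| + 1 by rewrite ltr_wpDl.
have [y Dy xy] := denD (S x) (eps / (`|M| + 1)) (divr_gt0 eps0 M0).
exists (T y); first by exists y.
rewrite -[x]ST -linearB; apply: (le_lt_trans (TM _)).
apply: (@le_lt_trans _ _ ((`|M| + 1) * vnorm (S x - y))).
  apply: ler_wpM2r; first exact: vnorm_ge0.
  by apply: (le_trans (ler_norm M)); rewrite lerDl.
by rewrite mulrC -ltr_pdivlMr.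
Qed.

Definition span_seq (e : nat -> H) : set H :=
  [set x | exists (n : nat) (c : nat -> K), x = \sum_(i < n) c i *: e i].

(** The new vector is the normalised residual of [d] when [d] lies outside the
    span of the previous vectors, and otherwise the normalised residual of any
    vector outside that span. *)
Lemma gram_schmidt_step (e : nat -> H) n d :
  infinite_dimensional H ->
  (forall i j, (i < n)%N -> (j < n)%N -> dot (e i) (e j) = (i == j)%:R) ->
  exists v, [/\ dot v v = 1, forall i, (i < n)%N -> dot v (e i) = 0
    & exists (c : nat -> K) a, d = \sum_(i < n) c i *: e i + a *: v].
Proof.
move=> hdim oe; pose r x := x - \sum_(i < n) dot x (e i) *: e i.
have r_orth x j : (j < n)%N -> dot (r x) (e j) = 0.
  move=> jn; rewrite dotBl dot_suml (bigD1 (Ordinal jn)) //= big1 => [|i ij].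
    by rewrite dotZl oe // eqxx mulr1 addr0 subrr.
  rewrite dotZl oe // (_ : (i == j :> nat) = false) ?mulr0 //.
  by apply: contraNF ij => /eqP ij; apply/eqP/val_inj.
have unit x : r x != 0 ->
    exists v, [/\ dot v v = 1, forall i, (i < n)%N -> dot v (e i) = 0
      & r x = `|r x| *: v].
  move=> rx0; have nx0 : `|r x| != 0 by rewrite normr_eq0.
  exists (`|r x|^-1 *: r x); split.
  - by rewrite -hnorm normrZ normfV normr_id mulVf // expr1n.
  - by move=> i ni; rewrite dotZl r_orth // mulr0.
  - by rewrite scalerA divff // scale1r.
have [rd0|/unit[v [v1 ve rv]]] := eqVneq (r d) 0.
  have [x xP] := hdim n (fun i => e i).
  have /unit[v [v1 ve _]] : r x != 0.
    by apply/eqP => /eqP; rewrite subr_eq0 => /eqP; exact: xP.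
  exists v; split => //; exists (fun i => dot d (e i)), 0.
  by rewrite scale0r addr0; apply/eqP; rewrite -subr_eq0; apply/eqP.
exists v; split => //; exists (fun i => dot d (e i)), `|r d|.
by rewrite -rv addrC subrK.
Qed.

(** Step [n] puts [d n] in the span of [e 0, ..., e n].  Every step yields a new
    vector, so that [e] is indexed by all of [nat] even if the [d n] are
    dependent. *)
Lemma gram_schmidt (d : nat -> H) : infinite_dimensional H ->
  exists e, orthonormal_seq e /\ range d `<=` span_seq e.
Proof.
move=> hdim.
pose onb_upto (s : seq H) := forall i j, (i < size s)%N -> (j < size s)%N ->
  dot s`_i s`_j = (i == j)%:R.
have /choice[next nextP] : forall p : seq H * H, exists v, onb_upto p.1 ->
    [/\ dot v v = 1, forall i, (i < size p.1)%N -> dot v p.1`_i = 0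
    & exists (c : nat -> K) a,
        p.2 = \sum_(i < size p.1) c i *: p.1`_i + a *: v].
  move=> [s x]; have [os|] := pselect (onb_upto s); last by exists 0.
  by have [v vP] := gram_schmidt_step x hdim os; exists v.
pose hist := fix hist n :=
  if n is m.+1 then rcons (hist m) (next (hist m, d m)) else [::].
pose e n := next (hist n, d n).
have histE n : hist n = mkseq e n by elim: n => // n IHn; rewrite mkseqS -IHn.
have onb n : forall i j, (i < n)%N -> (j < n)%N ->
    dot (e i) (e j) = (i == j)%:R.
  elim: n => // n IHn.
  have /nextP[/= v1 ve _] : onb_upto (hist n, d n).1.
    move=> i j; rewrite /= histE size_mkseq => ni nj.
    by rewrite !nth_mkseq ?IHn.
  have {}ve i : (i < n)%N -> dot (e n) (e i) = 0.
    move=> ni; have := ve i; rewrite -/(e n) histE size_mkseq nth_mkseq //.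
    exact.
  move=> i j; rewrite !ltnS.
  rewrite (leq_eqVlt i) (leq_eqVlt j) => /predU1P[->|ni] /predU1P[->|nj].
  - by rewrite eqxx.
  - by rewrite ve // gtn_eqF.
  - by rewrite ltn_eqF // dot_eq0C // ve.
  - exact: IHn.
exists e; split; first by move=> i j; apply: (onb (maxn i j).+1);
  rewrite ltnS ?leq_maxl ?leq_maxr.
move=> _ [n _ <-].
have /nextP[/= _ _ [c [a dn]]] : onb_upto (hist n, d n).1.
  move=> i j; rewrite /= histE size_mkseq => ni nj.
  by rewrite !nth_mkseq ?(onb n).
exists n.+1, (fun i => if (i < n)%N then c i else a).
rewrite big_ord_recr /= ltnn {}dn -/(e n) histE size_mkseq; congr (_ + _).
by apply: eq_bigr => i _; rewrite ltn_ord nth_mkseq.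
Qed.

Lemma countable_enum (D : set H) :
  countable D -> exists d : nat -> H, D `<=` range d.
Proof.
move=> /countable_injP[h h_inj].
exists (fun n => xget 0 [set x | D x /\ h x = n]) => x Dx; exists (h x) => //.
have [] : [set y | D y /\ h y = h x] (xget 0 [set y | D y /\ h y = h x]).
  by apply: (@xgetPex _ _ [set y | D y /\ h y = h x]); exists x.
by move=> Dy hy; apply: h_inj => //; rewrite inE.
Qed.

Lemma dense_subset (D E : set H) : D `<=` E -> dense D -> dense E.
Proof. by move=> DE dD O O0 oO; have [x [? /DE]] := dD O O0 oO; exists x. Qed.

Lemma exists_orthonormal_basis : separable H -> infinite_dimensional H ->
  exists e, orthonormal_seq e /\ dense (span_seq e).
Proof.
move=> [D [/countable_enum[d Dd] dD]] /(gram_schmidt d)[e [oe de]].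
by exists e; split => //; apply: dense_subset dD => x /Dd /de.
Qed.

(** * Interleaved families *)

Definition interleave (T : Type) (a b : nat -> T) (n : nat) : T :=
  if odd n then b n./2 else a n./2.

Lemma interleave_even T (a b : nat -> T) n : interleave a b n.*2 = a n.
Proof. by rewrite /interleave odd_double doubleK. Qed.

Lemma interleave_odd T (a b : nat -> T) n : interleave a b n.*2.+1 = b n.
Proof. by rewrite /interleave /= odd_double uphalf_double. Qed.

Lemma sum_double (V : zmodType) (F : nat -> V) n :
  \sum_(i < n.*2) F i = \sum_(i < n) F i.*2 + \sum_(i < n) F i.*2.+1.
Proof.
elim: n => [|n IHn]; first by rewrite !big_ord0 addr0.
by rewrite doubleS !big_ord_recr /= IHn -!addrA; congr (_ + _); rewrite addrCA.
Qed.

(** The partial sums of even length determine the sum, because a series of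
    nonnegative terms converges in the extended reals. *)
Lemma interleaved_series (a : nat -> R) s t : (forall i, 0 <= a i) ->
  \sum_(i < n) a i.*2 @[n --> \oo] --> s ->
  \sum_(i < n) a i.*2.+1 @[n --> \oo] --> t ->
  (\sum_(0 <= i <oo) (a i)%:E = (s + t)%:E)%E.
Proof.
move=> a0 a_s a_t.
pose S n := (\sum_(0 <= i < n) (a i)%:E)%E.
have S_cvg : cvgn S by apply: is_cvg_nneseries => i _ _; rewrite lee_fin.
have double_oo : (n.*2) @[n --> \oo] --> \oo.
  move=> A [N _ AN]; exists N => // n /= Nn; apply: AN => /=.
  by apply: leq_trans Nn _; rewrite -addnn leq_addr.
have S_lim : S n.*2 @[n --> \oo] --> limn S by exact: cvg_comp double_oo S_cvg.
have S_st : S n.*2 @[n --> \oo] --> (s + t)%:E.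
  rewrite (_ : (fun n => S n.*2) =
    (fun n => (\sum_(i < n) a i.*2 + \sum_(i < n) a i.*2.+1)%:E)).
    by apply: cvg_EFin; [near=> n | apply: cvgD].
  by apply/funext => n; rewrite /S sumEFin big_mkord sum_double.
exact: cvg_unique S_lim S_st.
Unshelve. all: by end_near. Qed.

(** * The two frames *)

Section Construction.
Variable e : nat -> H.
Hypothesis oe : orthonormal_seq e.
Hypothesis te : dense (span_seq e).

Lemma orthogonal_basis_eq0 x : (forall i, dot x (e i) = 0) -> x = 0.
Proof.
move=> xe; apply: (norm_dense_orthogonal (dense_norm_dense te)) => y [n [c ->]].
by rewrite dot_sumr big1 // => i _; rewrite dotZr xe mulr0.
Qed.

Lemma parseval_basis x :
  \sum_(i < n) abs_scalar (dot x (e i)) ^+ 2 @[n --> \oo] --> vnorm x ^+ 2.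
Proof.
have [E EP] := orthogonal_projection oe.
have := parseval oe EP (x := x).
by rewrite (proj_total oe EP x orthogonal_basis_eq0).
Qed.

(** The blocks have unbounded sizes, and sizes [4 ^ m] that are squares, so that
    normalising the sum of a block only takes the scalar [2 ^ m]. *)
Definition block m i : nat := (4 ^ m + i)%N.

Lemma block_inj m n i j : (i < 4 ^ m)%N -> (j < 4 ^ n)%N ->
  (block m i == block n j) = (m == n) && (i == j).
Proof.
move=> im jn; have [->|mn] := eqVneq m n; first by rewrite /= eqn_add2l.
apply/negbTE; wlog lt_mn : m n i j im jn mn / (m < n)%N.
  move=> wl; move: (mn); rewrite neq_ltn => /orP[]; first exact: wl.
  by rewrite eq_sym; apply: wl; rewrite // eq_sym.
rewrite neq_ltn; apply/orP; left; rewrite /block.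
have : (4 ^ m.+1 <= 4 ^ n)%N by rewrite leq_exp2l.
rewrite expnS => le4; apply: (@leq_trans (4 ^ n)); last exact: leq_addr.
apply: leq_trans le4; rewrite (mulnDl 1 3) mul1n ltn_add2l.
by apply: leq_trans im _; rewrite leq_pmull.
Qed.

Definition block_sum m : H := \sum_(i < 4 ^ m) e (block m i).
Definition block_unit m : H := (2 ^ m)%:R^-1 *: block_sum m.

Lemma dot_block_sum m i n : (i < 4 ^ m)%N ->
  dot (e (block m i)) (block_sum n) = (m == n)%:R.
Proof.
move=> im; rewrite dot_sumr; have [mn|mn] := eqVneq m n; last first.
  by rewrite big1 // => j _; rewrite oe block_inj // (negbTE mn).
rewrite -{n}mn (bigD1 (Ordinal im)) //= big1 => [|j ji].
  by rewrite oe eqxx addr0.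
rewrite oe block_inj // eqxx /= (_ : (i == j) = false) //.
by apply: contraNF ji => /eqP ij; apply/eqP/val_inj.
Qed.

(** The blocks are disjoint, and a sum of [4 ^ m] orthonormal vectors has norm
    [2 ^ m]. *)
Lemma orthonormal_block_unit : orthonormal_seq block_unit.
Proof.
move=> m n; rewrite dotZl dotZr {1}/block_sum dot_suml.
rewrite (eq_bigr (fun=> (m == n)%:R)) => [|i _]; last exact: dot_block_sum.
have [<-|_] := eqVneq m n; last by rewrite big1 // !mulr0.
rewrite mulrA -sqr_norm_scalar normfV normr_nat sumr_const card_ord exprVn.
by rewrite -natrX -expnM mulnC expnM mulVf // pnatr_eq0 expn_eq0.
Qed.

Variable P : {linear H -> H}.
Hypothesis projP : forall x, vcvg (fourier_sum block_unit x) (P x).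

Let ou := orthonormal_block_unit.

(** All basis vectors of a block have the same inner products with the
    [block_unit n]. *)
Lemma proj_block m i j : (i < 4 ^ m)%N -> (j < 4 ^ m)%N ->
  P (e (block m i)) = P (e (block m j)).
Proof.
move=> im jm; apply/eqP; rewrite -subr_eq0 -linearB; apply/eqP.
apply: (proj_eventually projP (N := 0%N)) => n _; rewrite /fourier_sum.
apply: big1 => l _; rewrite dotZr dotBl !dot_block_sum // subrr mulr0.
by rewrite scale0r.
Qed.

Lemma proj_block_sum m : P (block_sum m) = block_sum m.
Proof.
have m0 : (2 ^ m)%:R != 0 :> K by rewrite pnatr_eq0 expn_eq0.
have -> : block_sum m = (2 ^ m)%:R *: block_unit m.
  by rewrite scalerA divff // scale1r.
by rewrite linearZ /= (proj_id ou projP).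
Qed.

(** Self-adjointness moves [T] to [x] in the first half of the sum, which is
    then the Parseval sum of [T x]. *)
Lemma frame_series (T : {linear H -> H}) x :
  (forall y z, dot (T y) z = dot y (T z)) ->
  (\sum_(0 <= i <oo)
     (abs_scalar (dot x (interleave (T \o e) block_unit i)) ^+ 2)%:E
   = (vnorm (T x) ^+ 2 + vnorm (P x) ^+ 2)%:E)%E.
Proof.
move=> selfT; apply: interleaved_series => [i||]; first exact: sqr_ge0.
  under eq_fun do under eq_bigr do rewrite interleave_even /= -selfT.
  exact: parseval_basis.
under eq_fun do under eq_bigr do rewrite interleave_odd.
exact: parseval.
Qed.

(** [shrink t] multiplies the range of [P] by [1 - t] and is the identity on
    its orthogonal complement. *)
Definition shrink (t : K) : {linear H -> H} :=
  [the {linear H -> H} of idfun \- (t \*: P)].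

Lemma shrinkE t x : shrink t x = x - t *: P x. Proof. by []. Qed.

Lemma shrink_selfadjoint t : conj_scalar t = t ->
  forall x y, dot (shrink t x) y = dot x (shrink t y).
Proof.
move=> tt x y; rewrite !shrinkE dotBl dotBr dotZl dotZr tt.
by rewrite (proj_selfadjoint projP).
Qed.

Lemma sqr_vnorm_shrink t x :
  vnorm (shrink t x) ^+ 2
  = vnorm (x - P x) ^+ 2 + (abs_scalar (1 - t) * vnorm (P x)) ^+ 2.
Proof.
have -> : shrink t x = (x - P x) + (1 - t) *: P x.
  by rewrite shrinkE scalerBl scale1r addrA subrK.
by rewrite pythagoras ?vnormZ // dotZr (proj_orthogonal ou projP) mulr0.
Qed.

Lemma proj_shrink t x : P (shrink t x) = (1 - t) *: P x.
Proof.
rewrite shrinkE linearB linearZ /= (proj_idempotent ou projP).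
by rewrite scalerBl scale1r.
Qed.

Lemma shrink_bounded t : bounded_operator (shrink t).
Proof.
exists (1 + abs_scalar t) => x; rewrite shrinkE.
apply: (le_trans (vnormD _ _)); rewrite vnormN vnormZ mulrDl mul1r lerD2l.
by rewrite ler_wpM2l ?abs_scalar_ge0 ?(vnorm_proj_le ou projP).
Qed.

Definition half_scalar : K := 2^-1.

Lemma conj_half : conj_scalar half_scalar = half_scalar.
Proof.
rewrite /half_scalar; case: k => //=.
exact: etrans (conjc_inv _) (congr1 _ (conjc_nat R 2)).
Qed.

Lemma abs_half : abs_scalar half_scalar = 2^-1.
Proof.
have : abs_scalar (2 * half_scalar) = 1.
  by rewrite /half_scalar divff ?pnatr_eq0 // (abs_scalar_nat R k 1).
rewrite abs_scalarM (abs_scalar_nat R k 2) => h2.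
by apply: (mulfI (x := 2)); rewrite ?pnatr_eq0 // h2 divff ?pnatr_eq0.
Qed.

Lemma shrink_comp s t x : shrink s (shrink t x) = shrink (s + t - s * t) x.
Proof.
rewrite [LHS]shrinkE proj_shrink !shrinkE scalerA -addrA -opprD -scalerDl.
by congr (_ - _ *: _); rewrite mulrBr mulr1 addrA [t + s]addrC.
Qed.

(** The operator [1 - P / 2] has the inverse [1 + P]. *)
Lemma shrink_invertible : bounded_invertible (shrink half_scalar).
Proof.
have half2 : half_scalar + half_scalar = 1 by rewrite [1]splitr mul1r.
have shrink0 x : shrink 0 x = x by rewrite shrinkE scale0r subr0.
split; first exact: shrink_bounded.
exists (shrink (- 1)); split; first exact: shrink_bounded.
- move=> x; rewrite shrink_comp (_ : _ - _ = 0) ?shrink0 //.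
  by rewrite mulN1r opprK -addrA half2 addNr.
- move=> x; rewrite shrink_comp (_ : _ - _ = 0) ?shrink0 //.
  by rewrite mulrN1 opprK addrAC half2 subrr.
Qed.

Definition frame_with_basis := interleave (shrink half_scalar \o e) block_unit.
Definition frame_without_basis := interleave (shrink 1 \o e) block_unit.

Let evens : set nat := [set i | ~~ odd i].

(** The orthonormal basis is [e] reindexed by the even numbers, and the operator
    is [1 - P / 2]. *)
Lemma even_riesz_basis : riesz_basis dot evens frame_with_basis.
Proof.
exists (fun i => e i./2), (shrink half_scalar); split.
- split=> [i j ei ej|].
    rewrite oe; congr (nat_of_bool _)%:R; apply/eqP/eqP => [ij|-> //].
    by rewrite -(even_halfK ei) ij even_halfK.
  apply: dense_subset te => _ [n [c ->]].
  exists n.*2, (fun i => c i./2).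
  pose F i : H := if i \in evens then c i./2 *: e i./2 else 0.
  rewrite [RHS](_ : _ = \sum_(i < n.*2) F i); last by rewrite big_mkcond.
  rewrite sum_double [X in _ = _ + X]big1 => [|i _]; last first.
    by rewrite /F ifF //; apply/negbTE/negP; rewrite inE /evens /= odd_double.
  rewrite addr0; apply: eq_bigr => i _.
  by rewrite /F ifT ?doubleK // inE /evens /= odd_double.
- exact: shrink_invertible.
- by move=> i /negbTE; rewrite /frame_with_basis /interleave => ->.
Qed.

Lemma infinite_odds : infinite_set (~` evens).
Proof.
move=> /(finite_image (fun n => n./2)) fin; apply: infinite_nat.
apply: sub_finite_set fin => n _.
exists n.*2.+1; last by rewrite /= uphalf_double.
by rewrite /evens /= odd_double.
Qed.

(** With [h j] the image of [e j] under [1 - P], at most one index of each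
    block is missing from a subfamily that is a Riesz basis: if two were, the
    difference of the corresponding basis vectors would be orthogonal to the
    whole subfamily.  The vectors [h j] of a block sum to zero, so all but one
    of them sum to a vector of norm at most one, although the lower Riesz bound
    makes the norm of that sum grow with the size of the block. *)
Lemma not_contains_riesz_basis : ~ contains_riesz_basis dot frame_without_basis.
Proof.
move=> [J [e' [T [[oe' te'] [Tbd [S [[M SM] TS ST]]] gT]]]].
pose h := shrink 1 \o e.
have h_even i : frame_without_basis i.*2 = h i by exact: interleave_even.
have dot_shrink x y : P x = 0 -> dot x (shrink 1 y) = dot x y.
  move=> Px; rewrite shrinkE scale1r dotBr -(proj_selfadjoint projP) Px.
  by rewrite dot0l subr0.
have total v : (forall j, J j -> dot v (frame_without_basis j) = 0) -> v = 0.
  move=> vJ; apply: (norm_dense_orthogonal (norm_dense_image Tbd ST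
    (dense_norm_dense te'))) => _ [y [n [c ->]] <-].
  rewrite linear_sum dot_sumr big1 // => j; rewrite inE => Jj.
  by rewrite linearZ /= dotZr -gT // vJ // mulr0.
(* Since [m < 4 ^ m], this makes [4 ^ m - 1] larger than [M ^ 2]. *)
pose m := Num.Def.archi_bound (M ^+ 2 + 1).
have [i0 i0P] : exists i0 : 'I_(4 ^ m),
    forall i : 'I_(4 ^ m), i != i0 -> J (block m i).*2.
  have [[i0 Ji0]|all_in] :=
    pselect (exists i0 : 'I_(4 ^ m), ~ J (block m i0).*2); last first.
    exists (Ordinal (expn_gt0 4 m)) => i _; apply: contrapT => Ji.
    by apply: all_in; exists i.
  exists i0 => i1; rewrite -val_eqE => i10; apply: contrapT => Ji1.
  (* Orthogonal to the whole subfamily if both indices are missing. *)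
  pose v := e (block m i0) - e (block m i1).
  have Pv : P v = 0 by rewrite linearB /= (@proj_block m i0 i1) ?subrr.
  suff v0 : v = 0.
    have : dot v (e (block m i0)) = 1.
      by rewrite dotBl !oe eqxx block_inj // eqxx (negbTE i10) subr0.
    by move/eqP; rewrite v0 dot0l eq_sym oner_eq0.
  apply: total => j Jj; rewrite /frame_without_basis /interleave.
  case: (boolP (odd j)) => jodd.
    by rewrite -(dot_proj ou projP) Pv dot0l.
  rewrite dot_shrink // dotBl !oe.
  have neq i : ~ J (block m i).*2 -> (block m i == j./2) = false.
    by move=> Ji; apply/eqP => ij; apply: Ji; rewrite ij even_halfK.
  by rewrite !neq // subrr.
(* All coefficients equal to 1: the norm of [x] is the square root of
   [4 ^ m - 1], whereas that of [T x] is at most 1. *)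
pose x := \sum_(i < 4 ^ m | i != i0) e' (block m i).*2.
have x_sqr : vnorm x ^+ 2 = (4 ^ m)%:R - 1.
  have -> : x = \sum_(i < 4 ^ m | i != i0) 1 *: e' (block m i).*2.
    by apply: eq_bigr => i _; rewrite scale1r.
  rewrite sqr_vnorm_orthonormal_sum => [|i j /i0P Ji /i0P Jj].
    rewrite (abs_scalar_nat R k 1) expr1n sumr_const.
    rewrite (eq_card (B := predC1 i0)) // cardC1 card_ord -subn1.
    by rewrite natrB ?expn_gt0.
  by rewrite oe' // -!muln2 eqn_pmul2r // block_inj // eqxx.
have Tx : T x = - h (block m i0).
  apply/eqP; rewrite -addr_eq0 /x linear_sum /=.
  rewrite (eq_bigr (fun i : 'I__ => h (block m i))) => [|i /i0P Ji]; last first.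
    by rewrite -gT // h_even.
  have : shrink 1 (block_sum m) = 0.
    by rewrite shrinkE scale1r proj_block_sum subrr.
  by rewrite linear_sum (bigD1 i0) // addrC => /eqP.
have h_le i : vnorm (h i) <= 1.
  rewrite -(ler_pXn2r (n := 2)) ?nnegrE ?vnorm_ge0 // expr1n.
  have : vnorm (e i) ^+ 2 = 1.
    by rewrite vnorm_sqr oe eqxx (re_scalar_nat R k 1).
  rewrite (sqr_vnorm_proj ou projP) => <-.
  have -> : h i = e i - P (e i) by rewrite -[P (e i)]scale1r.
  by rewrite lerDl sqr_ge0.
have x_le : vnorm x <= `|M|.
  rewrite -[x]TS; apply: (le_trans (SM _)); rewrite Tx vnormN.
  apply: (@le_trans _ _ (`|M| * vnorm (h (block m i0)))).
    by rewrite ler_wpM2r ?vnorm_ge0 ?ler_norm.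
  by rewrite -[leRHS]mulr1 ler_wpM2l.
have : (4 ^ m)%:R <= M ^+ 2 + 1.
  rewrite -lerBlDr -x_sqr -[M ^+ 2]real_normK ?num_real //.
  by rewrite ler_pXn2r ?nnegrE ?vnorm_ge0.
rewrite leNgt => /negP; apply.
have : M ^+ 2 + 1 < m%:R by apply: archi_boundP; rewrite addr_ge0 ?sqr_ge0.
by move/lt_trans; apply; rewrite ltr_nat ltn_expl.
Qed.

Lemma frame_with_basis_series x :
  (\sum_(0 <= i <oo) (abs_scalar (dot x (frame_with_basis i)) ^+ 2)%:E
   = (vnorm x ^+ 2 + 4^-1 * vnorm (P x) ^+ 2)%:E)%E.
Proof.
rewrite /frame_with_basis frame_series; last first.
  exact: shrink_selfadjoint conj_half.
rewrite sqr_vnorm_shrink (sqr_vnorm_proj ou projP x).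
have -> : abs_scalar (1 - half_scalar) = 2^-1.
  by rewrite [X in X - _]splitr mul1r addrK abs_half.
by rewrite exprMn exprVn -natrX addrAC.
Qed.

Lemma frame_without_basis_series x :
  (\sum_(0 <= i <oo) (abs_scalar (dot x (frame_without_basis i)) ^+ 2)%:E
   = (vnorm x ^+ 2)%:E)%E.
Proof.
rewrite /frame_without_basis frame_series; last first.
  by apply: shrink_selfadjoint; case: k => //=; exact: conjc1.
rewrite sqr_vnorm_shrink subrr abs_scalar0 mul0r expr0n addr0.
by rewrite -(sqr_vnorm_proj ou projP x).
Qed.

Lemma lower_frame_bound_with_basis : lower_frame_bound dot frame_with_basis 1.
Proof.
split=> // x; rewrite frame_with_basis_series mul1r lee_fin lerDl.
by rewrite mulr_ge0 ?invr_ge0 ?sqr_ge0.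
Qed.

Lemma frame_with_basis_is_frame : frame dot frame_with_basis.
Proof.
split; first by exists 1; exact: lower_frame_bound_with_basis.
exists 2; split=> // x; rewrite frame_with_basis_series lee_fin.
rewrite mulrDl mul1r lerD2l (sqr_vnorm_proj ou projP x).
apply: (@le_trans _ _ (vnorm (P x) ^+ 2)); last by rewrite lerDr sqr_ge0.
by rewrite ler_piMl ?sqr_ge0 // invf_le1 ?ler1n ?ltr0n.
Qed.

Lemma frame_without_basis_is_frame : frame dot frame_without_basis.
Proof.
by split; exists 1; split=> // x; rewrite frame_without_basis_series mul1r.
Qed.

(** The left-hand side is half the norm of [P] applied to an orthonormal
    expansion whose coefficients are the even-indexed [c i]. *)
Lemma perturbation_bound n (c : 'I_n -> K) :
  vnorm (\sum_(i < n) c i *: (frame_with_basis i - frame_without_basis i))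
    <= 2^-1 * Num.sqrt (\sum_(i < n) abs_scalar (c i) ^+ 2).
Proof.
have shrinkB x : shrink half_scalar x - shrink 1 x = half_scalar *: P x.
  rewrite !shrinkE opprB addrC addrA subrK -scalerBl.
  by rewrite [X in X - _]splitr mul1r addrK.
have -> : \sum_(i < n) c i *: (frame_with_basis i - frame_without_basis i)
    = half_scalar *: P (\sum_(i < n | ~~ odd i) c i *: e i./2).
  rewrite linear_sum scaler_sumr [RHS]big_mkcond; apply: eq_bigr => i _.
  rewrite /frame_with_basis /frame_without_basis /interleave.
  case: (odd i); first by rewrite subrr scaler0.
  by rewrite [_ - _]shrinkB [P (c i *: _)]linearZ /= !scalerA mulrC.
rewrite vnormZ abs_half ler_pM2l ?invr_gt0 //.
apply: (le_trans (vnorm_proj_le ou projP _)).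
rewrite -(ler_pXn2r (n := 2)) ?nnegrE ?vnorm_ge0 ?sqrtr_ge0 //.
rewrite sqr_sqrtr; last by apply: sumr_ge0 => i _; exact: sqr_ge0.
rewrite sqr_vnorm_orthonormal_sum => [|i j ei ej].
  rewrite big_mkcond /=; apply: ler_sum => i _.
  by case: ifP => // _; exact: sqr_ge0.
rewrite oe; congr (nat_of_bool _)%:R; apply/eqP/eqP => [ij|-> //].
by apply/val_inj; rewrite /= -(even_halfK ei) ij even_halfK.
Qed.

End Construction.
End InnerProduct.

Theorem mainTheorem5 (R : realType) (k : scalar_kind)
    (H : completeNormedModType (scalar_field R k))
    (dot : {dot H for @conj_scalar R k})
    (hnorm : norm_induced_by dot)
    (hsep : separable H)
    (hdim : infinite_dimensional H) :
  exists (f g : nat -> H) (A lambda mu : R),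
    [/\ frame dot f, lower_frame_bound dot f A,
        contains_riesz_basis dot f & infinite_excess dot f] /\
    (frame dot g /\ ~ contains_riesz_basis dot g) /\
    [/\ 0 <= lambda, 0 <= mu, lambda + mu / Num.sqrt A < 1
      & forall (n : nat) (c : 'I_n -> scalar_field R k),
          vnorm (\sum_(i < n) c i *: (f i - g i))
            <= lambda * vnorm (\sum_(i < n) c i *: f i)
               + mu * Num.sqrt (\sum_(i < n) abs_scalar (c i) ^+ 2)].
Proof.
have [e [oe te]] := exists_orthonormal_basis hnorm hsep hdim.
have [P projP] := orthogonal_projection hnorm (orthonormal_block_unit oe).
have riesz_f := even_riesz_basis hnorm oe te projP.
exists (frame_with_basis e P), (frame_without_basis e P), 1, 0, 2^-1.
split; last split; split.
- exact: frame_with_basis_is_frame.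
- exact: lower_frame_bound_with_basis.
- by exists [set i | ~~ odd i].
- by exists [set i | ~~ odd i]; split => //; exact: infinite_odds.
- exact: frame_without_basis_is_frame.
- exact: not_contains_riesz_basis.
- by [].
- by rewrite invr_ge0.
- by rewrite sqrtr1 divr1 add0r invf_lt1 ?ltr1n.
- by move=> n c; rewrite mul0r add0r; exact: perturbation_bound.
Qed.
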